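(* Let $p \neq 2$ be a prime, and define $e = \nu_p(F(p - \epsilon))$. Let $$N(p) = \left\lvert\left\{F(i) \bmod p^e : i \text{ is a Lucas non-zero with respect to } p\right\}\right\rvert,$$ and let $Z(p)$ be the number of Lucas zeros $i$ with respect to $p$ such that $F(i) \not\equiv F(j) \pmod{p^e}$ for all Lucas non-zeros $j$ with respect to $p$. Then $$\operatorname{dens}(p) = \frac{N(p)}{p^e} + \frac{Z(p)}{2 p^{2e-1}(p+1)}.$$
   Context: $F(n)_{n\ge 0}$ is the Fibonacci sequence: $F(0)=0$, $F(1)=1$, $F(n+2)=F(n+1)+F(n)$. $L(n)_{n\ge 0}$ is the Lucas sequence: $L(0)=2$, $L(1)=1$, $L(n+2)=L(n+1)+L(n)$. For a prime $p$, the limiting density is $$\operatorname{dens}(p) = \lim_{\lambda\to\infty} \frac{\lvert\{F(n) \bmod p^\lambda : n \ge 0\}\rvert}{p^\lambda}$$ (the limit exists, since the sequence of quotients is non-increasing in $\lambda$). $\pi(p)$ is the period length of the Fibonacci sequence modulo $p$, i.e. the smallest integer $m \ge 1$ such that $F(n+m)\equiv F(n) \pmod p$ for all $n\ge 0$. An integer $i \in \{0,1,\dots,\pi(p)-1\}$ is a Lucas zero (with respect to $p$) if $L(i)\equiv 0 \pmod p$, and a Lucas non-zero if $L(i)\not\equiv 0 \pmod p$. $\nu_p(n)$ is the exponent of the highest power of $p$ dividing $n$. The number $\epsilon$ is $1$ if $p\equiv 1,4 \pmod 5$, $-1$ if $p\equiv 2,3 \pmod 5$, and $0$ if $p=5$.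 *)

(* Defs.v *)
From HB Require Import structures.
From mathcomp Require Import all_boot all_order all_algebra.
From mathcomp Require Import all_classical all_reals all_analysis.
Set Implicit Arguments.
Unset Strict Implicit.
Unset Printing Implicit Defensive.
Import Order.TTheory GRing.Theory Num.Theory.
Import numFieldNormedType.Exports.

Fixpoint fib (n : nat) : nat :=
  match n with
  | 0 => 0
  | 1 => 1
  | (n'.+1 as n1).+1 => fib n1 + fib n'
  end.

Fixpoint lucas (n : nat) : nat :=
  match n with
  | 0 => 2
  | 1 => 1
  | (n'.+1 as n1).+1 => lucas n1 + lucas n'
  end.

Definition fib_residues (m : nat) : {set 'I_m} :=
  [set r : 'I_m | `[< exists n : nat, nat_of_ord r = fib n %% m >]].

Definition fib_density (R : realType) (p l : nat) : R :=
  (#|fib_residues (p ^ l)|%:R / (p ^ l)%:R)%R.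

(* [limn] is only meaningful for convergent sequences; convergence is
   [is_cvg_fib_density] below. *)
Definition dens (R : realType) (p : nat) : R := limn (fib_density R p).

Lemma card_fib_residuesM (m p : nat) : 0 < m -> 0 < p ->
  #|fib_residues (m * p)| <= #|fib_residues m| * p.
Proof.
move=> m0 p0.
have dP (r : 'I_(m * p)) : r %/ m < p by rewrite ltn_divLR// [leqRHS]mulnC.
pose f (r : 'I_(m * p)) : 'I_m * 'I_p :=
  (Ordinal (ltn_pmod r m0), Ordinal (dP r)).
have f_inj : injective f.
  move=> r s [rs_mod rs_div]; apply: val_inj => /=.
  by rewrite (divn_eq r m) (divn_eq s m) rs_mod rs_div.
have -> : #|fib_residues m| * p =
    #|finset.setX (fib_residues m) [set: 'I_p]%SET|.
  by rewrite cardsX cardsT card_ord.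
rewrite -(card_imset _ f_inj).
apply/subset_leq_card/fintype.subsetP => _ /imsetP[r + ->].
rewrite !inE andbT !asboolE => -[n rE]; exists n.
by rewrite /= rE modn_dvdm// dvdn_mulr.
Qed.

Lemma is_cvg_fib_density (R : realType) (p : nat) : 0 < p ->
  cvgn (fib_density R p).
Proof.
move=> p0; apply: nonincreasing_is_cvgn; last first.
  by exists 0%R => _ [l _ <-]; rewrite /fib_density divr_ge0.
apply/nonincreasing_seqP => l; rewrite /fib_density.
have pl0 : 0 < p ^ l by rewrite expn_gt0 p0.
rewrite expnSr ler_pdivrMr ?ltr0n ?muln_gt0 ?pl0//.
rewrite natrM mulrA divfK ?pnatr_eq0 -?lt0n// -natrM ler_nat.
exact: card_fib_residuesM.
Qed.

Definition is_fib_period (m k : nat) : Prop :=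
  0 < k /\ forall n : nat, fib (n + k) = fib n %[mod m].

Definition is_least_fib_period (m k : nat) : Prop :=
  is_fib_period m k /\ forall k' : nat, is_fib_period m k' -> k <= k'.

(* The default value [0] is never taken for [m > 0], see [pisano_periodP]. *)
Definition pisano_period (m : nat) : nat := xget 0 (is_least_fib_period m).

Lemma ex_fib_period (m : nat) : 0 < m -> exists k, is_fib_period m k.
Proof.
case: m => // m _.
pose f (u : 'I_m.+1 * 'I_m.+1) := (u.2, (u.2 + u.1)%R).
have f_inj : injective f by move=> [a b] [c d] /pair_equal_spec[/= -> /addrI ->].
pose u0 : 'I_m.+1 * 'I_m.+1 := (inZp (fib 0), inZp (fib 1)).
have iterE n : iter n f u0 = (inZp (fib n), inZp (fib n.+1)).
  elim: n => // n IHn; rewrite iterS IHn /f /=; congr (_, _).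
  by apply: val_inj; rewrite /= modnDm.
exists (order f u0); split; first exact: order_gt0.
move=> n; have := iterE (n + order f u0).
by rewrite iterD iter_order// iterE => /(congr1 (fun u => val u.1)) /= ->.
Qed.

Lemma pisano_periodP (m : nat) : 0 < m ->
  is_least_fib_period m (pisano_period m).
Proof.
move=> /ex_fib_period exk; apply: xgetPex.
have exb : exists k, `[< is_fib_period m k >].
  by have [k kP] := exk; exists k; apply/asboolP.
case: (ex_minnP exb) => k /asboolP kP kmin; exists k; split => // k' k'P.
by apply: kmin; apply/asboolP.
Qed.

Definition lucas_zero (p i : nat) : bool := p %| lucas i.

Definition epsilon (p : nat) : int :=
  if p %% 5 \in [:: 1; 4] then 1%R
  else if p %% 5 \in [:: 2; 3] then (- 1)%R
  else 0%R.

(* The absolute value only converts [p - epsilon p : int] to [nat]; it is the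
   identity for [p > 0]. For prime [p] this exponent is positive, as [p] divides
   [fib (p - epsilon p)]; hence [2 * e - 1] is not truncated. *)
Definition fib_exponent (p : nat) : nat :=
  logn p (fib `|(p%:Z - epsilon p)%R|%N).

Definition lucas_nonzero_residues (p : nat) : {set 'I_(p ^ fib_exponent p)} :=
  [set r : 'I_(p ^ fib_exponent p) | [exists i : 'I_(pisano_period p),
     ~~ lucas_zero p i && (nat_of_ord r == fib i %% p ^ fib_exponent p)]].

Definition isolated_lucas_zeros (p : nat) : {set 'I_(pisano_period p)} :=
  [set i : 'I_(pisano_period p) | lucas_zero p i &&
     [forall j : 'I_(pisano_period p), ~~ lucas_zero p j ==>
        (fib i != fib j %[mod p ^ fib_exponent p])]].

(* Main.v *)
Require Import Defs.
From HB Require Import structures.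
From mathcomp Require Import all_boot all_order all_algebra all_field.
From mathcomp Require Import all_classical all_reals all_analysis.
From mathcomp Require Import zify ring.
Set Implicit Arguments.
Unset Strict Implicit.
Unset Printing Implicit Defensive.
Import Order.TTheory GRing.Theory Num.Theory.
Import numFieldNormedType.Exports.

(** Let [pi] be the period modulo [p]. The exponent of [p] in [F(pi * p^j)] is
  exactly [e + j], so the addition formulas
  [2 F(n+m) = F(n) L(m) + L(n) F(m)] and [2 L(n+m) = L(n) L(m) + 5 F(n) F(m)]
  allow Hensel lifting along [n + pi * q]. If [i] is a Lucas non-zero, the
  values [F(i + pi * q)] fill the whole class of [F(i)] modulo [p^e]. If [i] is
  a Lucas zero, the values [L(i + pi * q)] fill the class of [0] modulo [p^e],
  and since [5 F(n)^2 = L(n)^2 - 4 (-1)^n], where [F(n)] is a unit of known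
  class modulo [p], the residues [F(i + pi * q)] modulo [p^(2e+k)] correspond to
  the squares modulo [p^k]. These residues stay in the class of [F(i)] modulo
  [p^e], and distinct Lucas zeros yield disjoint sets. The squares have density
  [p / (2 (p + 1))]. *)

Local Open Scope ring_scope.

Local Notation F n := (Posz (fib n)).
Local Notation L n := (Posz (lucas n)).


(** * Addition formulas for Fibonacci and Lucas numbers *)

Lemma fibSSz n : F n.+2 = F n.+1 + F n.
Proof. by []. Qed.

(** Turns each Lucas identity below into a polynomial identity in consecutive Fibonacci numbers. *)
Lemma lucas_fib n : L n = 2 * F n.+1 - F n.
Proof.
suff: L n = 2 * F n.+1 - F n /\ L n.+1 = 2 * F n.+2 - F n.+1 by case.
elim: n => [//|n [IHn IHSn]]; split=> //.
have -> : L n.+2 = L n.+1 + L n by [].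
by rewrite IHn IHSn !fibSSz; ring.
Qed.

Lemma fib_addSn m n : F (m + n).+1 = F m.+1 * F n.+1 + F m * F n.
Proof.
elim: n m => [|n IHn] m; first by rewrite addn0 /=; ring.
by rewrite addnS -addSn IHn !fibSSz; ring.
Qed.

Lemma fib_addn m n : F (m + n) = F m * F n.+1 + F m.+1 * F n - F m * F n.
Proof.
case: m => [|m]; first by rewrite add0n /=; ring.
by rewrite addSn fib_addSn !fibSSz; ring.
Qed.

Lemma fib_addn2 m n : 2 * F (m + n) = F m * L n + L m * F n.
Proof. by rewrite !lucas_fib fib_addn; ring. Qed.

Lemma lucas_addn2 m n : 2 * L (m + n) = L m * L n + 5 * F m * F n.
Proof. by rewrite !lucas_fib fib_addn fib_addSn; ring. Qed.

Lemma cassini n : F n.+1 ^+ 2 - F n.+1 * F n - F n ^+ 2 = (-1) ^+ n.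
Proof.
elim: n => [//|n IHn].
by rewrite [RHS]exprS -IHn !fibSSz; ring.
Qed.

Lemma lucas_sqr n : L n ^+ 2 = 5 * F n ^+ 2 + 4 * (-1) ^+ n.
Proof. by rewrite -cassini lucas_fib; ring. Qed.

(** * Periods and congruences *)

Lemma eqmod_int (a b m : nat) :
  a = b %[mod m] <-> (m %| a%:Z - b%:Z)%Z.
Proof.
rewrite -eqz_mod_dvd; split=> [ab|/eqP]; first by rewrite !modz_nat ab.
by rewrite !modz_nat => -[].
Qed.

(** Unlike [is_fib_period], this allows [k = 0], so it is stable under every multiple [q * k]. *)
Definition fib_shift (m k : nat) : Prop :=
  forall n : nat, fib (n + k) = fib n %[mod m].

Lemma fib_shift_mul m k q : fib_shift m k -> fib_shift m (q * k).
Proof.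
move=> kP; elim: q => [|q IHq] n; first by rewrite mul0n addn0.
by rewrite mulSn addnCA addnC kP.
Qed.

Lemma pisano_dvdn m k : (0 < m)%N -> is_fib_period m k ->
  (pisano_period m %| k)%N.
Proof.
move=> m0 [k0 kP]; have [piP pimin] := pisano_periodP m0.
have pi0 := proj1 piP; rewrite /dvdn; apply: contraT; rewrite -lt0n => r0.
have /pimin : is_fib_period m (k %% pisano_period m).
  split=> // n; rewrite -(fib_shift_mul (k %/ pisano_period m) (proj2 piP)).
  by rewrite -addnA [(k %% _ + _)%N]addnC -divn_eq kP.
by rewrite leqNgt ltn_mod pi0.
Qed.

Lemma dvdz_prime_pow_mul (p v : nat) (a b : int) : prime p ->
  ~~ (p %| a)%Z -> ((p ^ v)%N %| a * b)%Z = ((p ^ v)%N %| b)%Z.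
Proof.
by move=> pp pa; rewrite Gauss_dvdzr // coprimezE /= coprimeXl // prime_coprime.
Qed.

Lemma prime_not_dvdz (p a : nat) : prime p -> (0 < a < p)%N -> ~~ (p %| a%:Z)%Z.
Proof.
move=> pp /andP[a0 ap]; apply/negP => /(dvdn_leq a0).
by rewrite leqNgt ap.
Qed.

Lemma prime_ndvdz2 (p : nat) : prime p -> p != 2%N -> ~~ (p %| 2)%Z.
Proof.
move=> pp p2; apply: prime_not_dvdz => //=.
by have := prime_gt1 pp; lia.
Qed.

Lemma Euclid_dvdzM (p : nat) (a b : int) : prime p ->
  (p %| a * b)%Z = (p %| a)%Z || (p %| b)%Z.
Proof. by move=> pp; rewrite !dvdzE abszM Euclid_dvdM. Qed.

Lemma dvdz_expn_leq (p m n : nat) (x : int) : (m <= n)%N ->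
  ((p ^ n)%N %| x)%Z -> ((p ^ m)%N %| x)%Z.
Proof. by move=> mn; rewrite !dvdzE; apply: dvdn_trans; exact: dvdn_exp2l. Qed.

Lemma fib_shift_dvd m k : fib_shift m k -> (m %| F k)%Z.
Proof. by move=> /(_ 0%N) /eqmod_int; rewrite subr0. Qed.

Lemma fib_shift_lucas m k n : fib_shift m k -> (m %| L (n + k) - L n)%Z.
Proof.
move=> kP; rewrite !lucas_fib.
have /eqmod_int/dvdzP[a /eqP] := kP n; rewrite subr_eq => /eqP ->.
have /eqmod_int/dvdzP[b /eqP] := kP n.+1; rewrite subr_eq => /eqP ->.
by apply/dvdzP; exists (2 * b - a); ring.
Qed.

Lemma fib_shift_lucas2 m k : fib_shift m k -> (m %| L k - 2)%Z.
Proof. exact: (@fib_shift_lucas m k 0%N). Qed.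

(** Modulo [p], [F k] is 0 and [L k] is 2, so for odd [k] the identity L^2 = 5 F^2 - 4 would give p
    | 8. *)
Lemma fib_shift_even (p k : nat) : prime p -> p != 2%N ->
  fib_shift p k -> ~~ odd k.
Proof.
move=> pp p2 kP; apply/negP => kodd.
have := lucas_sqr k; rewrite -signr_odd kodd expr1.
have /dvdzP[a aE] := fib_shift_dvd kP.
have /dvdzP[b /eqP] := fib_shift_lucas2 kP; rewrite subr_eq aE => /eqP -> E.
have : (p %| 2 * (2 * 2))%Z.
  apply/dvdzP; exists (5 * a * a * p - b * b * p - 4 * b).
  have : (b * p + 2) ^+ 2 = 5 * (a * p) ^+ 2 - 4 :> int by rewrite E; ring.
  by lia.
by rewrite !Euclid_dvdzM // !(negbTE (prime_ndvdz2 pp p2)).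
Qed.

(** As [k] is even, (L k + 2)(L k - 2) = 5 (F k)^2, and L k + 2 is 4 modulo [p], hence a unit. The
    square doubles the exponent. *)
Lemma lucas_sub2_dvd (p v k : nat) : prime p -> p != 2%N -> fib_shift p k ->
  ((p ^ v)%N %| F k)%Z -> ((p ^ (v + v))%N %| L k - 2)%Z.
Proof.
move=> pp p2 kP /dvdzP[a aE].
rewrite -(@dvdz_prime_pow_mul p _ (L k + 2)) //; last first.
  apply/negP => Lk; have : (p %| 2 * 2)%Z.
    have /dvdzP[b bE] := Lk; have /dvdzP[c cE] := fib_shift_lucas2 kP.
    by apply/dvdzP; exists (b - c); rewrite mulrBl -bE -cE; ring.
  by rewrite Euclid_dvdzM // orbb; apply/negP/prime_ndvdz2.
have := lucas_sqr k.
rewrite -signr_odd (negbTE (fib_shift_even pp p2 kP)) expr0 mulr1 => E.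
have -> : (L k + 2) * (L k - 2) = 5 * F k ^+ 2.
  by transitivity (L k ^+ 2 - 4); [ring|rewrite E; ring].
apply/dvdzP; exists (5 * a * a); rewrite aE expnD PoszM; ring.
Qed.

(** Induction on [d] through 2 F((d+1)k) = F(dk) L(k) + L(dk) F(k), where both Lucas factors are 2
    modulo p^2. The exponent [v.+2] is what [exact_pow_fib_mulp] needs to exclude p^(v+2). *)
Lemma fib_mul_mod (p v k d : nat) : prime p -> p != 2%N -> fib_shift p k ->
  (0 < v)%N -> ((p ^ v)%N %| F k)%Z ->
  ((p ^ v.+2)%N %| F (d * k) - d%:Z * F k)%Z.
Proof.
move=> pp p2 kP v0 vF; elim: d => [|d IHd].
  by rewrite mul0n mul0r subr0 dvdz0.
rewrite -(@dvdz_prime_pow_mul p _ 2) ?prime_ndvdz2 //.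
have -> : 2 * (F (d.+1 * k) - d.+1%:Z * F k) = (F (d * k) - d%:Z * F k) * L k
    + d%:Z * ((L k - 2) * F k) + (L (d * k) - 2) * F k.
  by rewrite mulrBr mulSn addnC fib_addn2 intS; ring.
have dkP : fib_shift p (d * k) by exact: fib_shift_mul.
have prodP x : ((p ^ 2)%N %| x)%Z -> ((p ^ v.+2)%N %| x * F k)%Z.
  by move=> xP; rewrite -add2n expnD PoszM dvdz_mul.
have lucP j : fib_shift p j -> ((p ^ 2)%N %| L j - 2)%Z.
  move=> jP; apply: (@lucas_sub2_dvd p 1) => //.
  by rewrite expn1 fib_shift_dvd.
rewrite !rpredD ?(dvdz_mulr _ IHd) // ?prodP ?lucP //.
by rewrite dvdz_mull // prodP ?lucP.
Qed.

(** * Exact powers of [p] along multiples of a period *)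

Definition exact_pow (p v : nat) (x : int) : bool :=
  ((p ^ v)%N %| x)%Z && ~~ ((p ^ v.+1)%N %| x)%Z.

Lemma exact_pow_inj p v w x : exact_pow p v x -> exact_pow p w x -> v = w.
Proof.
move=> /andP[v1 v2] /andP[w1 w2]; apply/eqP; rewrite eqn_leq.
by apply/andP; split; rewrite leqNgt; apply/negP => h;
  [move: w2 => /negP; apply | move: v2 => /negP; apply]; apply: dvdz_expn_leq h _.
Qed.

Lemma exact_pow_logn p n : prime p -> (0 < n)%N -> exact_pow p (logn p n) n.
Proof.
move=> pp n0; apply/andP; split; first exact: pfactor_dvdnn.
by rewrite dvdzE /= pfactor_dvdn // ltnn.
Qed.

Lemma exact_pow_coprime p v x y : prime p ->
  exact_pow p v x -> ~~ (p %| y)%Z -> exact_pow p v (y * x).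
Proof. by move=> pp xP yP; rewrite /exact_pow !dvdz_prime_pow_mul. Qed.

Lemma exact_pow_eqmod p v w x y : (v < w)%N -> ((p ^ w)%N %| x - y)%Z ->
  exact_pow p v y -> exact_pow p v x.
Proof.
move=> vw xy; rewrite -[x](subrK y) /exact_pow.
by rewrite (rpredDl _ (dvdz_expn_leq (ltnW vw) xy)) (rpredDl _ (dvdz_expn_leq vw xy)).
Qed.

Lemma exact_pow_fib_mul p v k d : prime p -> p != 2%N -> fib_shift p k ->
  (0 < v)%N -> ~~ (p %| d)%N -> exact_pow p v (F k) ->
  exact_pow p v (F (d * k)).
Proof.
move=> pp p2 kP v0 pd vk; have /andP[vF _] := vk.
apply: (exact_pow_eqmod _ (fib_mul_mod d pp p2 kP v0 vF)) => //.
exact: exact_pow_coprime.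
Qed.

Lemma exact_pow_fib_mulp p v k : prime p -> p != 2%N -> fib_shift p k ->
  (0 < v)%N -> exact_pow p v (F k) -> exact_pow p v.+1 (F (p * k)).
Proof.
move=> pp p2 kP v0 vk; have /andP[vF nvF] := vk.
apply: (exact_pow_eqmod _ (fib_mul_mod p pp p2 kP v0 vF)) => //.
have p0 : p%:Z != 0 by case: (p) pp.
by rewrite /exact_pow (expnS p v) (expnS p v.+1) !PoszM !(dvdz_mul2l p0) vF.
Qed.

Lemma exact_pow_fib_mul_expp p v k j : prime p -> p != 2%N -> fib_shift p k ->
  (0 < v)%N -> exact_pow p v (F k) -> exact_pow p (v + j) (F (p ^ j * k)).
Proof.
move=> pp p2 kP v0 vk; elim: j => [|j IHj]; first by rewrite addn0 mul1n.
rewrite addnS expnS -mulnA exact_pow_fib_mulp ?addn_gt0 ?v0 //.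
exact: fib_shift_mul.
Qed.

(** * Hensel lifting along a period *)

Lemma solve_linear_mod (p : nat) (a b : int) : prime p -> ~~ (p %| a)%Z ->
  exists d : nat, (p %| b - a * d%:Z)%Z.
Proof.
move=> pp pa; have p0 : p%:Z != 0 by case: (p) pp.
have /eqP apE : coprimez p a by rewrite coprimezE prime_coprime.
have [u [v uvE]] := Bezoutz p a; rewrite apE in uvE.
exists `|((b * v) %% p)%Z|%N.
rewrite gez0_abs ?modz_ge0 // /modz; apply/dvdzP.
exists (u * b + a * (b * v %/ p)%Z).
transitivity (b * (u * p + v * a) - a * (b * v - (b * v %/ p)%Z * p)).
  by rewrite uvE mulr1.
by ring.
Qed.

(* Hensel lifting: replacing [n] by [n + d * p ^ j * k] changes [2 * G n] by
   [d * H n * F (p ^ j * k)] modulo [p ^ (e + j + 1)]. *)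
Lemma fib_shift_surj (p e k i : nat) (G H : nat -> int) (x : int) :
  prime p -> p != 2%N -> fib_shift p k -> (0 < e)%N -> exact_pow p e (F k) ->
  (forall m n, 2 * G (n + m)%N = G n * L m + H n * F m) ->
  (forall n, (p %| H (i + n * k)%N)%Z = (p %| H i)%Z) ->
  ~~ (p %| H i)%Z -> ((p ^ e)%N %| x - G i)%Z ->
  forall j, exists q : nat, ((p ^ (e + j))%N %| x - G (i + q * k)%N)%Z.
Proof.
move=> pp p2 kP e0 ek GH HP Hi xP; elim=> [|j [q qP]].
  by exists 0%N; rewrite mul0n !addn0.
set n := (i + q * k)%N in qP; set l := (e + j)%N in qP *.
have l0 : (0 < l)%N by rewrite addn_gt0 e0.
set P := (p ^ j * k)%N.
have lP : exact_pow p l (F P) by apply: exact_pow_fib_mul_expp.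
have PP : fib_shift p P by exact: fib_shift_mul.
have /andP[/dvdzP[u uE] uP] := lP.
have [c cE] := dvdzP qP.
have pu : ~~ (p %| u)%Z.
  by apply: contra uP => /dvdzP[w wE]; rewrite uE wE expnS PoszM -mulrA dvdz_mull.
have pHu : ~~ (p %| H n * u)%Z by rewrite Euclid_dvdzM // HP negb_or Hi.
have [d dP] := solve_linear_mod (2 * c) pp pHu.
exists (q + d * p ^ j)%N; rewrite addnS -/l.
have -> : (i + (q + d * p ^ j) * k = n + d * P)%N.
  by rewrite mulnDl addnA mulnA.
rewrite -(@dvdz_prime_pow_mul p _ 2) ?prime_ndvdz2 //.
have /andP[lF _] := lP.
have FdP := fib_mul_mod d pp p2 PP l0 lF.
(* Modulo p^(l+1) the first term vanishes by the choice of [d], the second because p^(2l) divides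
   L(dP) - 2, the third by [fib_mul_mod]. *)
have -> : 2 * (x - G (n + d * P)%N) = (2 * c - H n * u * d%:Z) * (p ^ l)%N
   - G n * (L (d * P) - 2) - H n * (F (d * P) - d%:Z * F P).
  rewrite mulrBr GH; transitivity (2 * (x - G n) - G n * (L (d * P) - 2) - H n * F (d * P)); first by ring.
  by rewrite cE uE; ring.
rewrite !rpredB //.
- by rewrite expnS PoszM dvdz_mul.
- apply: dvdz_mull; apply: (@dvdz_expn_leq _ _ (l + l)); first by lia.
  apply: lucas_sub2_dvd => //; first exact: fib_shift_mul.
  rewrite -(subrK (d%:Z * F P) (F _)) rpredD ?dvdz_mull //.
  by apply: dvdz_expn_leq FdP; lia.
- by apply: dvdz_mull; apply: dvdz_expn_leq FdP; lia.
Qed.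

(** * The law of apparition *)

Lemma fib_binet (K : comPzRingType) (a b : K) n : a + b = 1 -> a * b = -1 ->
  (fib n)%:R * (a - b) = a ^+ n - b ^+ n.
Proof.
move=> ab1 abN1; have bE : b = 1 - a by rewrite -ab1 addrC addKr.
have a2 : a ^+ 2 = a + 1.
  apply/eqP; rewrite -subr_eq0; apply/eqP; transitivity (- (a * b) - 1).
    by rewrite bE; ring.
  by rewrite abN1 opprK subrr.
have b2 : b ^+ 2 = b + 1 by transitivity (a ^+ 2 + b - a); rewrite ?a2 bE; ring: a2.
suff: (fib n)%:R * (a - b) = a ^+ n - b ^+ n /\
  (fib n.+1)%:R * (a - b) = a ^+ n.+1 - b ^+ n.+1 by case.
elim: n => [|n [IHn IHSn]]; first by split; rewrite /= ?expr0 ?expr1; ring.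
split=> //; have -> : fib n.+2 = (fib n.+1 + fib n)%N by [].
rewrite natrD mulrDl IHn IHSn -addn2 -addn1 !exprD !expr1 a2 b2; ring.
Qed.

(** Writing the roots of X^2 - X - 1 through a fifth root of unity lets the Frobenius action be read
    off from [p %% 5], without quadratic reciprocity. *)
Lemma exists_root5 (p : nat) : prime p -> exists (K : fieldType) (z : K),
  p \in [pchar K] /\ z ^+ 4 + z ^+ 3 + z ^+ 2 + z + 1 = 0.
Proof.
move=> pp; have [K [f _]] := countable_algebraic_closure 'F_p.
have pK : p \in [pchar K] by rewrite (fmorph_pchar f) pchar_Fp.
pose P : {poly K} := \poly_(i < 5) 1.
have /closed_rootP[z /eqP zP] : size P != 1%N by rewrite size_poly_eq ?oner_eq0.
exists K, z; split=> //.
by move: zP; rewrite horner_poly !big_ord_recl big_ord0 /= !mul1r => <-; ring.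
Qed.

(* For [z] a primitive fifth root of unity, [- (z ^+ 2 + z ^+ 3)] and
   [- (z + z ^+ 4)] are the roots of X^2 - X - 1; the Frobenius map fixes or
   swaps them according to the class of [p] modulo [5]. *)
Lemma fib_apparition (p : nat) : prime p -> p != 5%N ->
  let m := `|(p%:Z - epsilon p)%R|%N in
  (p %| fib m)%N /\ fib_shift p (2 * m).
Proof.
move=> pp p5 m; have [K [z [pK z0]]] := exists_root5 pp.
pose a := - (z ^+ 2 + z ^+ 3); pose b := - (z + z ^+ 4).
have z5 : z ^+ 5 = 1.
  apply/eqP; rewrite -subr_eq0; apply/eqP.
  transitivity ((z - 1) * (z ^+ 4 + z ^+ 3 + z ^+ 2 + z + 1)); first by ring.
  by rewrite z0 mulr0.
have ab1 : a + b = 1.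
  transitivity (1 - (z ^+ 4 + z ^+ 3 + z ^+ 2 + z + 1)); first by rewrite /a /b; ring.
  by rewrite z0 subr0.
have abN1 : a * b = -1.
  transitivity (z ^+ 3 + z ^+ 4 + z ^+ 5 * (z + z ^+ 2)); first by rewrite /a /b; ring.
  rewrite z5 mul1r; transitivity (z ^+ 4 + z ^+ 3 + z ^+ 2 + z + 1 - 1); first by ring.
  by rewrite z0 sub0r.
have ba1 : b + a = 1 by rewrite addrC.
have baN1 : b * a = -1 by rewrite mulrC.
have frobE i j : (- (z ^+ i + z ^+ j)) ^+ p = - (z ^+ (i * (p %% 5)) + z ^+ (j * (p %% 5))).
  rewrite -(pFrobenius_autE pK) rmorphN rmorphD /= !pFrobenius_autE -!exprM.
  rewrite -(expr_mod (i * p) z5) -(expr_mod (j * p) z5) -modnMmr.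
  by rewrite -[(j * p %% 5)%N]modnMmr !(expr_mod _ z5).
have abP : (a ^+ p = if (p %% 5)%N \in [:: 1; 4]%N then a else b)
    /\ (b ^+ p = if (p %% 5)%N \in [:: 1; 4]%N then b else a).
  have : (p %% 5 < 5)%N by rewrite ltn_mod.
  have : (p %% 5 != 0)%N by rewrite -/(5 %| p)%N dvdn_prime2 // eq_sym.
  have bE : b = - (z ^+ 1 + z ^+ 4) by rewrite expr1.
  have z6 : z ^+ 6 = z by rewrite (exprD z 5 1) z5 mul1r expr1.
  have z8 : z ^+ 8 = z ^+ 3 by rewrite (exprD z 5 3) z5 mul1r.
  have z9 : z ^+ 9 = z ^+ 4 by rewrite (exprD z 5 4) z5 mul1r.
  have z12 : z ^+ 12 = z ^+ 2 by rewrite (exprD z 5 7) (exprD z 5 2) z5 !mul1r.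
  have z16 : z ^+ 16 = z by rewrite (exprD z 10 6) (exprM z 5 2) z5 expr1n mul1r.
  rewrite [a ^+ p]frobE bE frobE -bE /a /b.
  case: (p %% 5)%N => [|[|[|[|[|//]]]]] //= _ _; rewrite ?inE /=;
    split; rewrite ?z6 ?z8 ?z9 ?z12 ?z16 ?expr1 //; ring.
(* If Frobenius fixes [a] and [b], their powers of exponent p - 1 are 1; if it swaps them, their
   powers of exponent p + 1 are a b = -1. *)
have abm : a ^+ m = b ^+ m /\ (a ^+ m) ^+ 2 = 1.
  have [aP bP] := abP; have p0 := prime_gt0 pp.
  have a0 : a != 0 by apply: contra_eq_neq abN1 => ->; rewrite mul0r eq_sym oppr_eq0 oner_eq0.
  have b0 : b != 0 by apply: contra_eq_neq abN1 => ->; rewrite mulr0 eq_sym oppr_eq0 oner_eq0.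
  move: aP bP; rewrite /m /epsilon; case: ifP => [_|h1] aP bP.
    have -> : `|(p%:Z - 1)%R|%N = p.-1 by lia.
    have a1 : a ^+ p.-1 = 1 by apply: (mulIf a0); rewrite -exprSr prednK // mul1r.
    have b1 : b ^+ p.-1 = 1 by apply: (mulIf b0); rewrite -exprSr prednK // mul1r.
    by rewrite a1 b1 expr1n.
  case: ifP => [_|h2].
    have -> : `|(p%:Z - -1)%R|%N = p.+1 by lia.
    by rewrite (exprS a p) (exprS b p) aP bP baN1 abN1 sqrrN expr1n.
  have : (p %% 5 < 5)%N by rewrite ltn_mod.
  have : (p %% 5 != 0)%N by rewrite -/(5 %| p)%N dvdn_prime2 // eq_sym.
  by case: (p %% 5)%N h1 h2 => [|[|[|[|[|//]]]]].
have [am a2m] := abm; have fibE n := fib_binet n ab1 abN1.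
have ab0 : a - b != 0.
  apply/eqP => ab0; have : (a - b) ^+ 2 = 5.
    transitivity ((a + b) ^+ 2 - 4 * (a * b)); first by ring.
    by rewrite ab1 abN1; ring.
  rewrite ab0 expr0n /= => /esym/eqP; rewrite -(dvdn_pcharf pK).
  by rewrite dvdn_prime2 // (negbTE p5).
split.
  by rewrite (dvdn_pcharf pK) -(mulIr_eq0 _ (mulIf ab0)) fibE am subrr.
move=> n; apply/eqmod_int; rewrite (dvdz_pcharf pK) rmorphB /= subr_eq0.
apply/eqP/(mulIf ab0); rewrite -!pmulrn !fibE mulnC !exprD !exprM.
by rewrite -am a2m !mulr1.
Qed.

(** * The exact power of [p] in [F] at the period *)

Lemma fib_gt0 n : (0 < n)%N -> (0 < fib n)%N.
Proof.
case: n => // n _; suff: (0 < fib n.+1)%N && (0 < fib n.+2)%N by case/andP.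
elim: n => [//|n /andP[IH1 IH2]]; rewrite IH2.
have -> : fib n.+3 = (fib n.+2 + fib n.+1)%N by [].
by rewrite addn_gt0 IH2.
Qed.

(** Multiplying the index by [q] prime to [p] keeps the exact power, which is unique; so it can also
    be read backwards from [q * k] to [k]. *)
Lemma exact_pow_fib_inv (p e k q : nat) : prime p -> p != 2%N ->
  fib_shift p k -> (0 < k)%N -> ~~ (p %| q)%N ->
  exact_pow p e (F (q * k)) -> exact_pow p e (F k).
Proof.
move=> pp p2 kP k0 pq eqk.
have kw := exact_pow_logn pp (fib_gt0 k0).
have w0 : (0 < logn p (fib k))%N.
  by rewrite logn_gt0 mem_primes pp fib_gt0 //; exact: (fib_shift_dvd kP).
have qkw := exact_pow_fib_mul pp p2 kP w0 pq kw.
by rewrite (exact_pow_inj eqk qkw).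
Qed.

Lemma pisano_shift (m : nat) : (0 < m)%N -> fib_shift m (pisano_period m).
Proof. by move=> /pisano_periodP[[]]. Qed.

Lemma pisano_gt0 (m : nat) : (0 < m)%N -> (0 < pisano_period m)%N.
Proof. by move=> /pisano_periodP[[]]. Qed.

(** The difference is 4 (-1)^n. Hence [p] cannot divide [L n] together with [F n] or with 5. *)
Lemma prime_ndvdz_lucas_sqr (p n : nat) : prime p -> p != 2%N ->
  ~~ (p %| L n ^+ 2 - 5 * F n ^+ 2)%Z.
Proof.
move=> pp p2; have -> : L n ^+ 2 - 5 * F n ^+ 2 = 2 * 2 * (-1) ^+ n.
  by rewrite lucas_sqr; ring.
rewrite !Euclid_dvdzM // !(negbTE (prime_ndvdz2 pp p2)) /=.
by rewrite dvdzE abszX exp1n dvdn1; case: (p) pp => [|[|]].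
Qed.

Lemma exact_pow_fib_double (p e m : nat) : prime p -> p != 2%N ->
  (0 < e)%N -> exact_pow p e (F m) -> exact_pow p e (F (2 * m)).
Proof.
move=> pp p2 e0 em; have -> : F (2 * m)%N = L m * F m.
  by rewrite mul2n -addnn lucas_fib fib_addn; ring.
apply: exact_pow_coprime => //; apply/negP => pL.
have pF : (p %| F m)%Z.
  by have /andP[h _] := em; have := dvdz_expn_leq e0 h; rewrite expn1.
have /negP := prime_ndvdz_lucas_sqr m pp p2; apply.
by rewrite rpredB ?dvdz_mull ?dvdz_exp.
Qed.

(** Otherwise 4 would be a multiple of the period modulo 5, but F(4) = 3. *)
Lemma pisano5_dvd (d : nat) : (d * pisano_period 5 = 20)%N -> ~~ (5 %| d)%N.
Proof.
move=> dE; apply/negP => /dvdnP[c cE].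
have c4 : (c * pisano_period 5 = 4)%N by move: dE; rewrite cE; lia.
have /fib_shift_dvd : fib_shift 5 (c * pisano_period 5).
  exact/fib_shift_mul/pisano_shift.
by rewrite c4.
Qed.

Lemma fib_shift5 : fib_shift 5 20.
Proof.
(* The coefficients are (F(19) - 1) / 5 and F(20) / 5. *)
move=> n; apply/eqmod_int/dvdzP; exists (836 * F n + 1353 * F n.+1).
by rewrite fib_addn (_ : F 20 = 6765) // (_ : F 21 = 10946) //; ring.
Qed.

Lemma fib_exponent_gt0 (p : nat) : prime p -> (0 < fib_exponent p)%N.
Proof.
move=> pp; have [->//|p5] := eqVneq p 5%N.
have [pF _] := fib_apparition pp p5.
rewrite logn_gt0 mem_primes pp pF fib_gt0 //.
by rewrite /epsilon; have := prime_gt1 pp; do 2?[case: ifP => _]; lia.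
Qed.

(** With m = p - epsilon, the period divides 2m with cofactor prime to [p], and F(2m) contains the
    same power of [p] as F(m). For p = 5, where [p] divides m, the period 20 is used instead. *)
Lemma exact_pow_fib_pisano (p : nat) : prime p -> p != 2%N ->
  exact_pow p (fib_exponent p) (F (pisano_period p)).
Proof.
move=> pp p2; have p0 := prime_gt0 pp.
have piP := pisano_shift p0; have pi0 := pisano_gt0 p0.
have [pE|p5] := eqVneq p 5%N.
  rewrite pE in pp p2 p0 piP pi0 *.
  have /dvdnP[d /esym dE] : (pisano_period 5 %| 20)%N.
    by apply: pisano_dvdn => //; split=> //; exact: fib_shift5.
  apply: (exact_pow_fib_inv pp p2 piP pi0 (pisano5_dvd dE)).
  (* F(20) = 6765 is divisible by 5 but not by 25, and here e = 1. *)
  by rewrite dE.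
have [pF shiftP] := fib_apparition pp p5.
set m := `|(p%:Z - epsilon p)%R|%N in pF shiftP.
have m0 : (0 < m)%N.
  by rewrite /m /epsilon; do 2?[case: ifP => _]; have := prime_gt1 pp; lia.
have pm : ~~ (p %| 2 * m)%N.
  rewrite Euclid_dvdM // negb_or (prime_ndvdz2 pp p2) /=.
  have p1 := prime_gt1 pp; rewrite /m /epsilon.
  case: ifP => [_|h1]; last case: ifP => [_|h2].
  - by rewrite (_ : `|_|%N = p.-1) ?gtnNdvd; lia.
  - rewrite (_ : `|_|%N = p.+1); last by lia.
    by rewrite -addn1 dvdn_addr // dvdn1; lia.
  - have : (p %% 5 < 5)%N by rewrite ltn_mod.
    have : (p %% 5 != 0)%N by rewrite -/(5 %| p)%N dvdn_prime2 // eq_sym.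
    by case: (p %% 5)%N h1 h2 => [|[|[|[|[|//]]]]].
have /dvdnP[d dE] : (pisano_period p %| 2 * m)%N.
  by apply: pisano_dvdn => //; split=> //; rewrite muln_gt0.
apply: (exact_pow_fib_inv (q := d) pp p2 piP pi0).
  by apply: contra pm; rewrite dE; exact: dvdn_mulr.
rewrite -dE; apply: exact_pow_fib_double => //; first exact: fib_exponent_gt0.
exact: (exact_pow_logn pp (fib_gt0 m0)).
Qed.

(** * Comparing cardinalities of residue sets *)

Definition residues (T : Type) (P : T -> Prop) (f : T -> nat) (m : nat) :
  {set 'I_m} := [set r : 'I_m | `[< exists2 t, P t & nat_of_ord r = (f t %% m)%N >]].

Lemma residuesP (T : Type) (P : T -> Prop) (f : T -> nat) (m : nat) (r : 'I_m) :
  reflect (exists2 t, P t & nat_of_ord r = (f t %% m)%N) (r \in residues P f m).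
Proof. by rewrite finset.inE; exact: asboolP. Qed.

(** Send each residue of [f] to the residue of [g] at a chosen index; the hypothesis makes this
    injective. *)
Lemma leq_card_residues (T : Type) (P : T -> Prop) (f g : T -> nat) (m n : nat) :
  (0 < n)%N ->
  (forall t u, P t -> P u -> g t = g u %[mod n] -> f t = f u %[mod m]) ->
  (#|residues P f m| <= #|residues P g n|)%N.
Proof.
move=> n0 gf.
pose h (r : 'I_m) : 'I_n :=
  if pselect (exists2 t, P t & nat_of_ord r = (f t %% m)%N) is left H
  then Ordinal (ltn_pmod (g (projT1 (cid2 H))) n0) else Ordinal n0.
have hP r : r \in residues P f m ->
    exists t, [/\ P t, nat_of_ord r = (f t %% m)%N & nat_of_ord (h r) = (g t %% n)%N].
  move=> /residuesP rP; rewrite /h; case: pselect => // H.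
  by case: (cid2 H) => t /= Pt rt; exists t.
rewrite -(@card_in_imset _ _ h).
  apply/subset_leq_card/fintype.subsetP => _ /imsetP[r /hP[t [Pt _ ht]] ->].
  by apply/residuesP; exists t.
move=> r s /hP[t [Pt rt ht]] /hP[u [Pu su hu]] hrs; apply: val_inj => /=.
by rewrite rt su; apply: gf => //; rewrite -ht -hu hrs.
Qed.

Lemma eq_card_residues (T : Type) (P : T -> Prop) (f g : T -> nat) (m n : nat) :
  (0 < m)%N -> (0 < n)%N ->
  (forall t u, P t -> P u -> f t = f u %[mod m] <-> g t = g u %[mod n]) ->
  #|residues P f m| = #|residues P g n|.
Proof.
move=> m0 n0 fg; apply/eqP; rewrite eqn_leq.
by rewrite !leq_card_residues // => t u Pt Pu /fg; apply.
Qed.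

(** * Squares modulo powers of an odd prime *)

Definition squares (m : nat) : {set 'I_m} :=
  residues (fun _ => True) (fun y => y ^ 2)%N m.

Definition unit_squares (p m : nat) : {set 'I_m} :=
  residues (fun y => ~~ (p %| y)%N) (fun y => y ^ 2)%N m.

(** Only one of y + z and y - z can be divisible by [p], since their sum 2y is not; that factor
    absorbs all of p^M. *)
Lemma sqr_eqmod (p M y z : nat) : prime p -> p != 2%N -> ~~ (p %| y)%N ->
  y ^ 2 = z ^ 2 %[mod p ^ M] ->
  y = z %[mod p ^ M] \/ (p ^ M %| y + z)%N.
Proof.
move=> pp p2 py /eqmod_int.
have -> : (y ^ 2)%N%:Z - (z ^ 2)%N%:Z = (y%:Z + z%:Z) * (y%:Z - z%:Z) by rewrite -!mulnn !PoszM; ring.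
have [pyz|pyz] := boolP (p %| y%:Z + z%:Z)%Z; last first.
  by rewrite dvdz_prime_pow_mul // => h; left; apply/eqmod_int.
rewrite mulrC dvdz_prime_pow_mul //; first by right.
apply/negP => pyz'; have : (p %| 2 * y%:Z)%Z.
  have -> : 2 * y%:Z = (y%:Z + z%:Z) + (y%:Z - z%:Z) by ring.
  by rewrite rpredD.
by rewrite Euclid_dvdzM // (negbTE (prime_ndvdz2 pp p2)) /=; apply/negP.
Qed.

(* As [p ^ M] is odd, exactly one of two opposite nonzero residues has a
   representative of given parity in [0, p ^ M[. *)
Lemma card_unit_squares (p M : nat) : prime p -> p != 2%N -> (0 < M)%N ->
  (2 * #|unit_squares p (p ^ M)|)%N = totient (p ^ M).
Proof.
move=> pp p2 M0; have p0 := prime_gt0 pp.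
have pM0 : (0 < p ^ M)%N by rewrite expn_gt0 p0.
have pMo : odd (p ^ M).
  by rewrite oddX; case: (even_prime pp) p2 => -> //; rewrite orbT.
have pdvd y : (p %| y %% p ^ M)%N = (p %| y)%N.
  by rewrite /dvdn modn_dvdm // dvdn_exp.
pose X := [set y : 'I_(p ^ M) | ~~ (p %| y)%N]%SET.
pose h (y : 'I_(p ^ M)) : 'I_(p ^ M) * bool :=
  (Ordinal (ltn_pmod (y ^ 2) pM0), odd y).
have h_inj : {in X &, injective h}.
  move=> y z; rewrite !finset.inE => py pz [] yz odd_yz; apply: val_inj => /=.
  have [|/dvdnP[c cE]] := sqr_eqmod pp p2 py yz; first by rewrite !modn_small.
  have c1 : c = 1%N.
    have := ltn_ord y; have := ltn_ord z.
    have y0 : (0 < y)%N by case: (nat_of_ord y) py; rewrite ?dvdn0.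
    by case: c cE => [|[|c]] //; lia.
  by move: (congr1 odd cE); rewrite c1 mul1n oddD odd_yz addbb pMo.
have -> : totient (p ^ M) = #|X|.
  rewrite totient_count_coprime big_mkord cardsE -sum1_card big_mkcond /=.
  rewrite [RHS]big_mkcond /=; apply: eq_bigr => y _.
  by rewrite coprime_pexpl // prime_coprime // unfold_in /=; case: (_ %| _)%N.
have hX : h @: X = finset.setX (unit_squares p (p ^ M)) [set: bool]%SET.
  apply/setP => -[s b]; rewrite finset.in_setX finset.in_setT andbT.
  apply/imsetP/residuesP => [[y]|[t pt st]].
    by rewrite finset.inE => py [-> _]; exists (nat_of_ord y).
  have [tb|tb] := eqVneq (odd (t %% p ^ M)) b.
    exists (Ordinal (ltn_pmod t pM0)); first by rewrite finset.inE /= pdvd.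
    rewrite /h /= tb; congr (_, _); apply: val_inj => /=.
    by rewrite st modnXm.
  have t0 : (0 < t %% p ^ M)%N.
    by rewrite lt0n; apply: contra pt => /eqP tE; rewrite -pdvd tE.
  have tlt : (p ^ M - t %% p ^ M < p ^ M)%N by rewrite ltn_subrL t0 pM0.
  have tle : (t %% p ^ M <= p ^ M)%N by rewrite ltnW // ltn_mod.
  exists (Ordinal tlt).
    by rewrite finset.inE /= dvdn_subr ?pdvd // dvdn_exp.
  rewrite /h /=; congr (_, _); last first.
    by rewrite oddB // pMo /=; case: (odd _) tb; case: (b).
  apply: val_inj => /=; rewrite st -modnXm; apply/esym/eqmod_int.
  rewrite -!mulnn !PoszM -subzn //; apply/dvdzP.
  exists ((p ^ M)%N%:Z - 2 * (t %% p ^ M)%N%:Z); ring.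
by rewrite -(card_in_imset h_inj) hX cardsX cardsT card_bool mulnC.
Qed.

(** Squares of units and squares of multiples of [p] are disjoint, and (p z)^2 modulo p^(m+2)
    amounts to z^2 modulo p^m. *)
Lemma card_squaresSS (p m : nat) : prime p -> p != 2%N ->
  (2 * #|squares (p ^ m.+2)| = p.-1 * p ^ m.+1 + 2 * #|squares (p ^ m)|)%N.
Proof.
move=> pp p2; have p0 := prime_gt0 pp.
have p20 : (0 < p ^ 2)%N by rewrite expn_gt0 p0.
pose N := residues (fun _ => True) (fun z => (p * z) ^ 2)%N (p ^ m.+2).
have -> : #|squares (p ^ m)| = #|N|.
  apply: eq_card_residues; rewrite ?expn_gt0 ?p0 // => y z _ _.
  rewrite !expnMn -[m.+2]add2n expnD -!muln_modr; split=> [->//|/eqP].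
  by rewrite eqn_pmul2l // => /eqP.
have -> : squares (p ^ m.+2) = (unit_squares p (p ^ m.+2) :|: N)%SET.
  apply/setP => s; rewrite finset.in_setU.
  apply/residuesP/orP => [[y _ sE]|[] /residuesP[y Py sE]].
  - have [/dvdnP[z zE]|py] := boolP (p %| y)%N; last by left; apply/residuesP; exists y.
    by right; apply/residuesP; exists z; rewrite // mulnC -zE.
  - by exists y.
  - by exists (p * y)%N.
rewrite cardsU (_ : _ :&: _ = finset.set0)%SET ?cards0 ?subn0.
  by rewrite mulnDr card_unit_squares // totient_pfactor.
apply/setP => s; rewrite finset.in_setI finset.in_set0; apply/negP => /andP[].
move=> /residuesP[y py sE] /residuesP[z _]; rewrite sE => /eqP yz.
have : (p %| y ^ 2 %% p ^ m.+2)%N.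
  by rewrite (eqP yz) /dvdn modn_dvdm ?dvdn_exp // expnMn -/(_ %| _)%N dvdn_mulr // dvdn_exp.
by rewrite /dvdn modn_dvdm ?dvdn_exp // -/(_ %| _)%N Euclid_dvdX // (negbTE py).
Qed.

(** The recursion has step 2, and even exponents suffice for a limit along a subsequence. *)
Lemma card_squares (p k : nat) : prime p -> p != 2%N ->
  (2 * p.+1 * #|squares (p ^ (2 * k))| = p ^ (2 * k).+1 + p.+2)%N.
Proof.
move=> pp p2; elim: k => [|k IHk].
  rewrite muln0 expn0 expn1 (_ : #|_| = 1%N); first by lia.
  apply/eqP; rewrite eqn_leq (leq_trans (max_card _)) ?card_ord //=.
  by apply/card_gt0P; exists ord0; apply/residuesP; exists 0%N.
have E := card_squaresSS (2 * k) pp p2; rewrite (mulnS 2 k).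
rewrite add2n; move: IHk E; rewrite (expnS _ (2 * k).+2) (expnS _ (2 * k).+1).
move: (p ^ _.+1)%N #|_| #|_| (prime_gt0 pp) => q S' S p0 IHk E.
transitivity (p.+1 * (2 * S'))%N; first by ring.
rewrite E mulnDr; transitivity (p.+1 * (p.-1 * q) + 2 * p.+1 * S)%N; first by ring.
by rewrite IHk -(prednK p0) /=; ring.
Qed.

(** * Residues at Lucas zeros *)

Lemma fib_shiftI (p v k : nat) : prime p -> p != 2%N ->
  ((p ^ v)%N %| F k)%Z -> ((p ^ v)%N %| L k - 2)%Z -> fib_shift (p ^ v) k.
Proof.
move=> pp p2 Fk Lk n; apply/eqmod_int.
rewrite -(@dvdz_prime_pow_mul p _ 2) ?prime_ndvdz2 //.
have -> : 2 * (F (n + k) - F n) = F n * (L k - 2) + L n * F k.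
  by rewrite mulrBr fib_addn2; ring.
by rewrite rpredD ?dvdz_mull.
Qed.

(** The period modulo [p] still works modulo p^e, so the class of F(n) modulo p^e depends only on n
    modulo the period. *)
Lemma fib_shift_pisano (p : nat) : prime p -> p != 2%N ->
  fib_shift (p ^ fib_exponent p) (pisano_period p).
Proof.
move=> pp p2; have /andP[eF _] := exact_pow_fib_pisano pp p2.
apply: fib_shiftI => //; apply: (@dvdz_expn_leq _ _ (fib_exponent p + fib_exponent p)).
  exact: leq_addr.
exact/lucas_sub2_dvd/eF/pisano_shift/prime_gt0.
Qed.

Lemma lucas_zero_fib (p i : nat) : prime p -> p != 2%N -> lucas_zero p i ->
  ~~ (p %| F i)%Z.
Proof.
move=> pp p2 pL; apply/negP => pF.
have /negP := prime_ndvdz_lucas_sqr i pp p2; apply.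
by rewrite rpredB ?dvdz_mull ?dvdz_exp.
Qed.

Lemma lucas_zero_neq5 (p i : nat) : prime p -> p != 2%N -> lucas_zero p i ->
  ~~ (p %| 5)%Z.
Proof.
move=> pp p2 pL; apply/negP => p5.
have /negP := prime_ndvdz_lucas_sqr i pp p2; apply.
by rewrite rpredB ?dvdz_exp // dvdz_mulr.
Qed.

Lemma fib_double n : F (n + n) = F n * L n.
Proof. by rewrite lucas_fib fib_addn; ring. Qed.

Lemma lucas_double n : L (n + n) = L n ^+ 2 - 2 * (-1) ^+ n.
Proof. by rewrite -cassini !lucas_fib fib_addn fib_addSn; ring. Qed.

(* A Lucas zero [i] has [4 * i] as a Fibonacci period modulo [p], so that
   [F (4 * i) = F i * L i * L (2 * i)] is divisible by [p ^ e]. *)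
Lemma lucas_zero_exp (p i : nat) : prime p -> p != 2%N -> lucas_zero p i ->
  ((p ^ fib_exponent p)%N %| L i)%Z.
Proof.
move=> pp p2 pL; have p0 := prime_gt0 pp.
have pLi : (p %| L i)%Z by [].
pose j := (i + i)%N; pose k := (j + j)%N.
have Fk : F k = L j * (F i * L i) by rewrite fib_double mulrC fib_double.
have pLj : ~~ (p %| L j)%Z.
  apply/negP; rewrite lucas_double rpredBl ?rpredX ?dvdz_exp //.
  rewrite Euclid_dvdzM // (negbTE (prime_ndvdz2 pp p2)) /=.
  by rewrite dvdzE abszX exp1n dvdn1; case: (p) pp => [|[|]].
have kP : fib_shift p k.
  rewrite -(expn1 p); apply: fib_shiftI; rewrite ?expn1 //.
    by rewrite Fk !dvdz_mull.
  have -> : L k - 2 = L j * L j - 4.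
    by rewrite lucas_double -signr_odd oddD addbb expr0; ring.
  rewrite lucas_double.
  have -> : (L i ^+ 2 - 2 * (-1) ^+ i) * (L i ^+ 2 - 2 * (-1) ^+ i) - 4
     = (L i ^+ 3 - 4 * (-1) ^+ i * L i) * L i + 4 * ((-1) ^+ i * (-1) ^+ i - 1).
    by ring.
  by rewrite -expr2 sqrr_sign subrr mulr0 addr0 dvdz_mull.
have i0 : (0 < i)%N by rewrite lt0n; apply: contraTneq pL => ->; exact: (prime_ndvdz2 pp p2).
have /dvdnP[q qE] : (pisano_period p %| k)%N.
  by apply: pisano_dvdn => //; split=> //; rewrite !addn_gt0 i0.
have := fib_shift_dvd (fib_shift_mul q (fib_shift_pisano pp p2)).
by rewrite -qE Fk !dvdz_prime_pow_mul // lucas_zero_fib.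
Qed.

Definition fib_class (p i m : nat) : {set 'I_m} :=
  residues (fun _ => True) (fun q => fib (i + q * pisano_period p)) m.

(** Write L(n q) = p^e l(q). The period is even, so the signs in [lucas_sqr] agree and 5 (F(n q)^2 -
    F(n r)^2) = p^(2e) (l(q)^2 - l(r)^2). As F(n q) + F(n r) is 2 F(i) modulo [p], a unit,
    congruence of the Fibonacci values modulo p^(2e+k) is congruence of the squares modulo p^k. *)
Lemma card_fib_class (p i k : nat) : prime p -> p != 2%N -> lucas_zero p i ->
  let e := fib_exponent p in
  #|fib_class p i (p ^ (e + (e + k)))| = #|squares (p ^ k)|.
Proof.
move=> pp p2 pL e; have p0 := prime_gt0 pp.
have piP := pisano_shift p0.
have pi_even : ~~ odd (pisano_period p) by exact: (fib_shift_even pp p2 piP).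
pose n q := (i + q * pisano_period p)%N.
have sgn_n q : (-1) ^+ n q = (-1) ^+ i :> int.
  by rewrite -signr_odd oddD oddM (negbTE pi_even) andbF addbF signr_odd.
have Ln q : lucas_zero p (n q).
  have pLi : (p %| L i)%Z by [].
  rewrite -[lucas_zero _ _]/(p %| L (n q))%Z -[L (n q)](subrK (L i)) rpredD //.
  exact/fib_shift_lucas/fib_shift_mul.
have Fn q : (p %| F (n q) - F i)%Z.
  by apply/eqmod_int; exact: fib_shift_mul.
have p5 := lucas_zero_neq5 pp p2 pL.
pose l q := (lucas (n q) %/ p ^ e)%N.
have lE q : L (n q) = (l q)%:Z * (p ^ e)%N%:Z.
  by rewrite -PoszM divnK //; exact: (lucas_zero_exp pp p2 (Ln q)).
have -> : squares (p ^ k) = residues (fun _ => True) (fun q => l q ^ 2)%N (p ^ k).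
  apply/setP => s; apply/residuesP/residuesP => [[y _ sE]|[q _ sE]]; last by exists (l q).
  (* Hensel lifting for [L], with unit derivative 5 F, shows that [l] takes every value modulo
     p^k. *)
  have [q] : exists q, ((p ^ (e + k))%N %| (y * p ^ e)%N%:Z - L (n q))%Z.
    apply: (fib_shift_surj (i := i) (G := fun n => L n) (H := fun n => 5 * F n)
      pp p2 piP _ _ _ _ _ _ k).
    - exact: fib_exponent_gt0.
    - exact: exact_pow_fib_pisano.
    - by move=> a b; rewrite lucas_addn2.
    - move=> q; rewrite !Euclid_dvdzM //; congr (_ || _).
      by rewrite -[F (i + _)](subrK (F i)) (rpredDl _ (Fn q)).
    - by rewrite Euclid_dvdzM // negb_or p5 lucas_zero_fib.
    - by rewrite rpredB ?(lucas_zero_exp pp p2 pL) // PoszM dvdz_mull.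
  rewrite lE PoszM -mulrBl expnD mulrC PoszM dvdz_mul2l; last first.
    by rewrite -lt0n expn_gt0 p0.
  move=> /eqmod_int yl; exists q => //.
  by rewrite sE -modnXm yl modnXm.
apply: eq_card_residues; rewrite ?expn_gt0 ?p0 // => q r _ _.
have pFF : ~~ (p %| F (n q) + F (n r))%Z.
  apply/negP => h; have /negP := lucas_zero_fib pp p2 pL; apply.
  have : (p %| 2 * F i)%Z.
    have -> : 2 * F i = F (n q) + F (n r) - (F (n q) - F i) - (F (n r) - F i) by ring.
    by rewrite (rpredB (rpredB h (Fn q)) (Fn r)).
  by rewrite Euclid_dvdzM // (negbTE (prime_ndvdz2 pp p2)).
have E : 5 * ((F (n q) + F (n r)) * (F (n q) - F (n r))) =
    (p ^ (e + e))%N%:Z * ((l q ^ 2)%N%:Z - (l r ^ 2)%N%:Z).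
  transitivity (L (n q) ^+ 2 - L (n r) ^+ 2).
    by rewrite !lucas_sqr !sgn_n; ring.
  by rewrite !lE -!mulnn expnD !PoszM; ring.
have pe0 : (p ^ (e + e))%N%:Z != 0 by rewrite -lt0n expn_gt0 p0.
split=> /eqmod_int h; apply/eqmod_int.
  rewrite -(dvdz_mul2l pe0) -E dvdz_mull // dvdz_mull //.
  by rewrite -PoszM -expnD -addnA.
rewrite -(dvdz_prime_pow_mul _ _ pp pFF) -(dvdz_prime_pow_mul _ _ pp p5) E.
by rewrite addnA (expnD p (e + e) k) PoszM dvdz_mul2l.
Qed.

(** * Counting the Fibonacci residues modulo p^(2e+k) *)

Lemma card_preim_modn (m q n : nat) (S : {set 'I_m}) : (0 < m)%N -> n = (m * q)%N ->
  #|[set r : 'I_n | [exists s in S, (nat_of_ord s == r %% m)%N]]%SET| = (#|S| * q)%N.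
Proof.
move=> m0 ->; have [->|q0] := posnP q.
  rewrite !muln0; apply/eqP; rewrite -leqn0 (leq_trans (max_card _)) //.
  by rewrite card_ord.
have dP (r : 'I_(m * q)) : (r %/ m < q)%N by rewrite ltn_divLR // [leqRHS]mulnC.
pose f (r : 'I_(m * q)) : 'I_m * 'I_q :=
  (Ordinal (ltn_pmod r m0), Ordinal (dP r)).
have f_inj : injective f.
  move=> r s [rs_mod rs_div]; apply: val_inj => /=.
  by rewrite (divn_eq r m) (divn_eq s m) rs_mod rs_div.
rewrite -(card_imset _ f_inj) -[q in RHS]card_ord -cardsT -cardsX.
congr #|pred_of_set _|; apply/setP => -[a b]; rewrite finset.in_setX finset.in_setT andbT.
apply/imsetP/idP => [[r]|aS].
  rewrite finset.inE => /existsP[s /andP[sS /eqP sr]] [-> _].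
  by rewrite (_ : Ordinal _ = s) //; apply: val_inj => /=; rewrite sr.
have abP : (b * m + a < m * q)%N.
  rewrite (@leq_trans (b.+1 * m)) //; first by rewrite mulSn addnC ltn_add2r.
  by rewrite mulnC leq_mul2l ltn_ord orbT.
exists (Ordinal abP).
  rewrite finset.inE; apply/existsP; exists a.
  by rewrite aS /= modnMDl modn_small.
rewrite /f; congr (_, _); apply: val_inj => /=.
  by rewrite modnMDl modn_small.
by rewrite divnMDl // divn_small ?addn0.
Qed.

Lemma card_disjoint_bigcup (I T : finType) (A : {set I}) (B : I -> {set T}) c :
  (forall i, i \in A -> #|B i| = c) ->
  (forall i j, i \in A -> j \in A -> i != j -> [disjoint B i & B j]) ->
  #|\bigcup_(i in A) B i|%SET = (#|A| * c)%N.
Proof.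
move=> cB dB; rewrite big_mkcond /= -sum1_card partition_disjoint_bigcup.
  rewrite (eq_bigr (fun i => if i \in A then c else 0)%N) => [|i _].
    by rewrite -big_mkcond sum_nat_const.
  by rewrite sum1_card; case: ifP => [/cB//|_]; rewrite cards0.
move=> i j ij; case: ifP => iA; last by rewrite -setI_eq0 finset.set0I.
case: ifP => jA; last by rewrite -setI_eq0 finset.setI0.
exact: dB.
Qed.

(** Two consecutive coincidences propagate upwards by the recurrence; smaller indices are reached by
    first adding [i] periods. *)
Lemma fib_shift_sub (m i d : nat) : (0 < m)%N ->
  fib (i + d) = fib i %[mod m] -> fib (i + d).+1 = fib i.+1 %[mod m] ->
  fib_shift m d.
Proof.
move=> m0 id0 id1.
have idn n : fib (n + i + d) = fib (n + i) %[mod m].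
  suff: fib (n + i + d) = fib (n + i) %[mod m] /\
        fib (n.+1 + i + d) = fib (n.+1 + i) %[mod m] by case.
  elim: n => [//|n [IH1 IH2]]; split=> //.
  have -> : fib (n.+2 + i + d) = (fib (n.+1 + i + d) + fib (n + i + d))%N by [].
  have -> : fib (n.+2 + i) = (fib (n.+1 + i) + fib (n + i))%N by [].
  by rewrite -modnDm IH1 IH2 modnDm.
have piP := fib_shift_mul i (pisano_shift m0).
have pi0 := pisano_gt0 m0.
move=> n; rewrite -(piP (n + d)%N) -(piP n).
have ile : (i <= i * pisano_period m)%N by rewrite leq_pmulr.
have := idn (n + (i * pisano_period m - i))%N.
by rewrite -[(n + _ + i)%N]addnA subnK // addnAC.
Qed.

(** Since 2 F(n+1) = L(n) + F(n), the next Fibonacci values agree too, so j - i would be a period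
    shorter than the least one. *)
Lemma lucas_zero_inj (p i j : nat) : prime p -> p != 2%N ->
  (i < pisano_period p)%N -> (j < pisano_period p)%N ->
  lucas_zero p i -> lucas_zero p j -> fib i = fib j %[mod p] -> i = j.
Proof.
move=> pp p2; wlog ij : i j / (i <= j)%N => [W|] ilt jlt Li Lj Fij.
  by case: (leqP i j) => [|/ltnW] ij; [|apply/esym]; apply: W.
apply/eqP; rewrite eqn_leq ij /= -subn_eq0 -leqn0 leqNgt; apply/negP => d0.
have d_shift : fib_shift p (j - i).
  apply: (@fib_shift_sub _ i); rewrite ?prime_gt0 // subnKC //.
  apply/eqmod_int; rewrite -(@dvdz_prime_pow_mul p 1 2) ?prime_ndvdz2 // expn1.
  have -> : 2 * (F j.+1 - F i.+1) = L j - L i + (F j - F i).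
    by rewrite !lucas_fib; ring.
  have iL : (p %| L i)%Z := Li; have jL : (p %| L j)%Z := Lj.
  by rewrite (rpredD (rpredB jL iL)) //; apply/eqmod_int.
have /(pisano_dvdn (prime_gt0 pp))/(dvdn_leq d0) : is_fib_period p (j - i) by [].
by rewrite leqNgt (leq_ltn_trans (leq_subr _ _) jlt).
Qed.

(** The residues split into [A], the full preimage of the classes modulo p^e of Lucas non-zeros, and
    one [fib_class] for each isolated Lucas zero. *)
Lemma card_fib_residues (p k : nat) : prime p -> p != 2%N ->
  let e := fib_exponent p in
  #|fib_residues (p ^ (e + (e + k)))| =
    (#|lucas_nonzero_residues p| * p ^ (e + k) +
     #|isolated_lucas_zeros p| * #|squares (p ^ k)|)%N.
Proof.
move=> pp p2 e; have p0 := prime_gt0 pp; set m := (p ^ _)%N.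
have m0 : (0 < m)%N by rewrite expn_gt0 p0.
have pe0 : (0 < p ^ e)%N by rewrite expn_gt0 p0.
have pem : (p ^ e %| m)%N by rewrite dvdn_exp2l // leq_addr.
have pm : (p %| m)%N.
  by rewrite dvdn_exp // addn_gt0 fib_exponent_gt0.
have piP := pisano_shift p0; have pi0 := pisano_gt0 p0.
have pieP := fib_shift_pisano pp p2.
pose A := [set r : 'I_m |
  [exists s in lucas_nonzero_residues p, (nat_of_ord s == r %% p ^ e)%N]]%SET.
pose Z := isolated_lucas_zeros p.
have cA : #|A| = (#|lucas_nonzero_residues p| * p ^ (e + k))%N.
  by apply: card_preim_modn; rewrite // -expnD.
have inA (r : 'I_m) : reflect (exists2 j : 'I_(pisano_period p),
    ~~ lucas_zero p j & r = fib j %[mod p ^ e]) (r \in A).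
  rewrite finset.inE; apply: (iffP existsP) => [[s]|[j jL rj]].
    rewrite finset.inE => /andP[/existsP[j /andP[jL /eqP sj]] /eqP sr].
    by exists j => //; rewrite -sr.
  exists (Ordinal (ltn_pmod (fib j) pe0)); rewrite finset.inE /= rj eqxx andbT.
  by apply/existsP; exists j; rewrite jL /=.
have inZ (i : 'I_(pisano_period p)) : i \in Z -> lucas_zero p i /\
    forall j : 'I_(pisano_period p), ~~ lucas_zero p j -> fib i <> fib j %[mod p ^ e].
  rewrite finset.inE => /andP[iL /forallP iP]; split=> // j jL.
  by have /implyP/(_ jL)/eqP := iP j.
have BP (i : 'I_(pisano_period p)) (r : 'I_m) : r \in fib_class p i m ->
    r = fib i %[mod p] /\ r = fib i %[mod p ^ e].
  move=> /residuesP[q _ ->]; rewrite !modn_dvdm //; split; exact: fib_shift_mul.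
have UE : fib_residues m = (A :|: \bigcup_(i in Z) fib_class p i m)%SET.
  apply/setP => r; rewrite finset.in_setU finset.inE; apply/asboolP/orP.
    case=> n rn; pose i := Ordinal (ltn_pmod n pi0).
    have nE : n = (i + n %/ pisano_period p * pisano_period p)%N.
      by rewrite addnC -divn_eq.
    have ri : r = fib i %[mod p ^ e].
      by rewrite rn modn_dvdm // [in LHS]nE; exact: fib_shift_mul.
    have [iZ|iZ] := boolP (i \in Z).
      right; apply/bigcupP; exists i => //.
      by apply/residuesP; exists (n %/ pisano_period p)%N; rewrite // -nE.
    left; apply/inA; have [iL|iL] := boolP (lucas_zero p i); last by exists i.
    (* A Lucas zero that is not isolated shares its class modulo p^e with a non-zero [j], so its
       values lie in [A]. *)
    move: iZ; rewrite finset.inE iL /= negb_forall => /existsP[j].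
    rewrite negb_imply negbK => /andP[jL /eqP ij].
    by exists j => //; rewrite ri.
  case=> [/inA[j jL rj]|/bigcupP[i _ /residuesP[q _ rq]]]; last first.
    by exists (i + q * pisano_period p)%N.
  (* Hensel lifting for [F], whose derivative [L] is a unit at the non-zero [j], reaches all of
     [A]. *)
  have [q] : exists q, (m %| r%:Z - F (j + q * pisano_period p))%Z.
    apply: (fib_shift_surj (i := j) (G := fun n => F n) (H := fun n => L n)
      pp p2 piP _ _ _ _ _ _ (e + k)).
    - exact: fib_exponent_gt0.
    - exact: exact_pow_fib_pisano.
    - by move=> a b; exact: fib_addn2.
    - move=> q; rewrite -[L (j + _)](subrK (L j)) rpredDl //.
      exact/fib_shift_lucas/fib_shift_mul.
    - exact: jL.
    - exact/eqmod_int.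
  by move=> /eqmod_int rE; exists (j + q * pisano_period p)%N; rewrite -rE modn_small.
rewrite UE cardsU (_ : A :&: _ = finset.set0)%SET ?cards0 ?subn0.
  rewrite cA; congr (_ + _)%N; apply: card_disjoint_bigcup.
    by move=> i /inZ[iL _]; exact: card_fib_class.
  move=> i j /inZ[iL _] /inZ[jL _]; apply: contraR.
  rewrite -setI_eq0 => /set0Pn[r]; rewrite finset.in_setI.
  move=> /andP[/BP[ri _] /BP[rj _]].
  apply/eqP/val_inj.
  exact: (lucas_zero_inj pp p2 (ltn_ord i) (ltn_ord j) iL jL (etrans (esym ri) rj)).
apply/setP => r; rewrite finset.in_setI finset.in_set0; apply/negP.
move=> /andP[/inA[j jL rj] /bigcupP[i /inZ[_ iP] /BP[_ ri]]].
by apply: (iP j jL); rewrite -ri.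
Qed.

(** * Passage to the limit *)

Theorem theorem1 (R : realType) (p : nat) (p_prime : prime p) (p_neq2 : p <> 2%N) :
  let e := fib_exponent p in
  let N := #|lucas_nonzero_residues p| in
  let Z := #|isolated_lucas_zeros p| in
  dens R p = (N%:R / p%:R ^+ e
              + Z%:R / (2 * p%:R ^+ (2 * e - 1)%N * (p%:R + 1)))%R.
Proof.
move=> e N Z; have p2 : p != 2%N by apply/eqP.
have p0 := prime_gt0 p_prime; have p1 := prime_gt1 p_prime.
have e0 : (0 < e)%N := fib_exponent_gt0 p_prime.
have pR0 : p%:R != 0 :> R by rewrite pnatr_eq0 -lt0n.
have pR1 : p%:R + 1 != 0 :> R by rewrite natr1 pnatr_eq0.
(* Exponents 2e + 2k, for which [card_squares] is explicit. *)
pose u k : nat := (e + (e + 2 * k))%N.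
pose c : R := Z%:R / (2 * (p%:R + 1) * p%:R ^+ (2 * e)%N).
have densE k : fib_density R p (u k) =
    N%:R / p%:R ^+ e + c * (p%:R + p.+2%:R * (p%:R^-1 ^+ 2) ^+ k).
  have := card_squares k p_prime p2 => /(congr1 (fun n => n%:R : R)).
  rewrite natrD !natrM natrX -(natr1 p) => SE.
  have SE' : #|squares (p ^ (2 * k))|%:R =
     (p%:R ^+ (2 * k).+1 + p.+2%:R) / (2 * (p%:R + 1)) :> R.
    have ne0 : 2 * (p%:R + 1) != 0 :> R by rewrite mulf_neq0 ?pnatr_eq0.
    by apply: (mulfI ne0); rewrite SE mulrC divfK.
  rewrite /fib_density card_fib_residues // -/e -/N -/Z natrD !natrM !natrX SE'.
  rewrite /u /c (exprD _ e (e + 2 * k)) (exprD _ e (2 * k)) (mul2n e) -addnn (exprD _ e e).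
  rewrite -exprM exprVn (exprS _ (2 * k)).
  by field; rewrite !expf_neq0 // pR1.
(* The whole sequence converges, so this subsequence has the same limit. *)
have sub_cvg : (fib_density R p (u k) @[k --> \oo] --> dens R p)%classic.
  apply: (cvg_comp u (fib_density R p)); last exact: is_cvg_fib_density.
  apply/cvgnyPge => A; near=> k.
  rewrite /u; apply: (@leq_trans k); last by lia.
  by near: k; exact: nbhs_infty_ge.
have -> : N%:R / p%:R ^+ e + Z%:R / (2 * p%:R ^+ (2 * e - 1)%N * (p%:R + 1)) =
    N%:R / p%:R ^+ e + c * (p%:R + p.+2%:R * 0).
  rewrite mulr0 addr0 /c; congr (_ + _).
  (* Since e > 0 the subtraction is not truncated, and the numerator [p] cancels one factor of
     p^(2e). *)
  set d := (2 * e - 1)%N; have -> : (2 * e)%N = d.+1 by rewrite /d; lia.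
  by rewrite exprSr; field; rewrite !expf_neq0 // pR0 pR1.
apply/(cvg_unique _ sub_cvg); first exact: norm_hausdorff.
rewrite (_ : (fun k => _) = (fun k => N%:R / p%:R ^+ e +
    c * (p%:R + p.+2%:R * (p%:R^-1 ^+ 2) ^+ k))); last exact/funext.
apply: cvgD; first exact: cvg_cst.
apply: cvgM; first exact: cvg_cst.
apply: cvgD; first exact: cvg_cst.
apply: cvgM; first exact: cvg_cst.
apply: cvg_expr.
rewrite ger0_norm ?exprn_ge0 ?invr_ge0 ?ler0n // exprn_ilt1 ?invr_ge0 ?ler0n //.
by rewrite invf_lt1 ?ltr1n ?ltr0n.
Unshelve. all: end_near.
Qed.
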